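(* Let $p, q_1, q_2 \in \mathbb{N}[x]$ be polynomials such that $p$ has non-zero constant term and degree at least two, and $q_1$ and $q_2$ each have degree at least one. Suppose that the polynomial $p(x)-x \in \mathbb{Z}[x]$ is primitive and has no repeated complex roots, and that each complex root $t$ of $p(x)-x$ satisfies $q_1(t)=q_2(t)$. Then $$x = p(x) \implies q_1(x) = q_2(x) \quad\text{rig-theoretically}.$$
   Context: $\mathbb{N}$ includes $0$, and $\mathbb{N}[x]$ is the set of polynomials with coefficients in $\mathbb{N}$. A polynomial over $\mathbb{Z}$ is primitive if the greatest common divisor of its coefficients is $1$. A rig is a set $A$ with elements $0,1$ and binary operations $+,\cdot$ such that $(A,0,+)$ is a commutative monoid, $(A,1,\cdot)$ is a monoid (not necessarily commutative), and for all $a,b,c\in A$: $a0=0=0a$, $a(b+c)=ab+ac$, $(b+c)a=ba+ca$. (That is, a semiring with $0$ and $1$.) A polynomial over $\mathbb{N}$ can be evaluated at any element of any rig. For $p_1,p_2,q_1,q_2\in\mathbb{N}[x]$, ''$p_1(x)=p_2(x)\implies q_1(x)=q_2(x)$ rig-theoretically'' means: for all rigs $A$ and all $a\in A$, if $p_1(a)=p_2(a)$ then $q_1(a)=q_2(a)$. Equivalently, $q_1$ and $q_2$ represent the same element of the quotient rig $\mathbb{N}[x]/(p_1=p_2)$, the quotient of $\mathbb{N}[x]$ by the smallest rig congruence (equivalence relation compatible with $+$ and $\cdot$) identifying $p_1$ with $p_2$. *)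

(* Defs.v *)
From HB Require Import structures.
From mathcomp Require Import all_boot all_order all_algebra.
From mathcomp Require Import all_real_closed.
From mathcomp Require Import reals.
Set Implicit Arguments.
Unset Strict Implicit.
Unset Printing Implicit Defensive.

Import Order.TTheory GRing.Theory Num.Theory.
Local Open Scope ring_scope.

(* Rigs are [pzSemiRingType]s: not necessarily commutative, and the trivial rig
   is included.  The library's [horner] requires a nontrivial semiring, hence
   the explicit sum; [rig_evalE] relates the two. *)
Definition rig_eval (A : pzSemiRingType) (p : {poly nat}) (a : A) : A :=
  \sum_(i < size p) a ^+ i *+ (p`_i)%R.

Lemma rig_evalE (A : nzSemiRingType) (p : {poly nat}) (a : A) :
  rig_eval p a = (map_poly (fun n : nat => n%:R : A) p).[a].
Proof.
rewrite (@horner_coef_wide _ (size p)); last exact: size_poly.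
by apply: eq_bigr => i _; rewrite coef_map_id0 // mulr_natl.
Qed.

Definition rig_implies (p1 p2 q1 q2 : {poly nat}) : Prop :=
  forall (A : pzSemiRingType) (a : A),
    rig_eval p1 a = rig_eval p2 a -> rig_eval q1 a = rig_eval q2 a.

Definition fixpoint_poly (p : {poly nat}) : {poly int} := map_poly Posz p - 'X.

(* [zcontents] carries the sign of the leading coefficient. *)
Definition primitive_zpoly (f : {poly int}) : Prop := `|zcontents f|%N = 1%N.

Definition complex_poly (R : realType) (f : {poly int}) : {poly complex R} :=
  map_poly (fun n : int => n%:~R) f.

Definition no_repeated_complex_roots (R : realType) (f : {poly int}) : Prop :=
  forall t : complex R,
    root (complex_poly R f) t -> mup t (complex_poly R f) = 1%N.

(* Main.v *)
Require Import Defs.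
From mathcomp Require Import all_boot all_order all_algebra.
From mathcomp Require Import all_real_closed.
From mathcomp Require Import reals ring.
Set Implicit Arguments.
Unset Strict Implicit.
Unset Printing Implicit Defensive.

Import Order.TTheory GRing.Theory Num.Theory.
Local Open Scope ring_scope.

(* Write [f = p - x].  Having simple roots only, [f] divides [q1 - q2] over the
   complex numbers, hence over the rationals, hence (Gauss) over the integers;
   splitting the quotient into positive and negative parts shows that [q1 + s]
   and [q2 + s] agree in any rig where [x = p(x)], for some [s] in [N[x]].
   It remains to cancel [s].  In the quotient rig put [u <= v] when [u + w = v]
   for some [w].  From [1 <= x] and [1 + x^n <= x] with [n >= 2] one derives
   [u <= x] for every [u]; in particular [x + x <= x], say [x + x + w = x], and
   [z = x + w] is then neutral for every [v >= x].  As [x <= q1, q2] and [s]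
   has an additive inverse relative to [z], cancellation holds. *)

Lemma rig_eval_wide (A : pzSemiRingType) (n : nat) (u : {poly nat}) (a : A) :
  (size u <= n)%N -> rig_eval u a = \sum_(i < n) a ^+ i *+ (u`_i)%R.
Proof.
move=> le_un; rewrite /rig_eval.
rewrite (big_ord_widen n (fun i => a ^+ i *+ (u`_i)%R)) // big_mkcond.
apply: eq_bigr => i _.
by case: ltnP => // le_ui; rewrite nth_default.
Qed.

Lemma rig_evalD (A : pzSemiRingType) (u v : {poly nat}) (a : A) :
  rig_eval (u + v) a = rig_eval u a + rig_eval v a.
Proof.
rewrite !(@rig_eval_wide _ (maxn (size u) (size v))) ?leq_maxl ?leq_maxr //.
  by rewrite -big_split; apply: eq_bigr => i _; rewrite coefD mulrnDr.
exact: size_polyD.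
Qed.

Lemma rig_evalC (A : pzSemiRingType) (c : nat) (a : A) :
  rig_eval c%:P a = c%:R.
Proof.
by rewrite (@rig_eval_wide _ 1) ?size_polyC_leq1 // big_ord1 coefC.
Qed.

Lemma rig_evalZ (A : pzSemiRingType) (c : nat) (u : {poly nat}) (a : A) :
  rig_eval (c *: u) a = rig_eval u a *+ c.
Proof.
rewrite !(@rig_eval_wide _ (size u)) ?size_scale_leq // -sumrMnl.
by apply: eq_bigr => i _; rewrite coefZ -mulrnA mulnC.
Qed.

Lemma rig_evalMX (A : pzSemiRingType) (u : {poly nat}) (a : A) :
  rig_eval (u * 'X) a = a * rig_eval u a.
Proof.
rewrite (@rig_eval_wide _ (size u).+1); last first.
  by rewrite (leq_trans (size_polyMleq _ _)) // size_polyX addn2.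
rewrite big_ord_recl coefMX mulr0n add0r mulr_sumr.
by apply: eq_bigr => i _; rewrite coefMX exprS mulrnAr.
Qed.

(** Only powers of the single element [a] occur, so [A] may be noncommutative: [mulrAC] swaps
    factors in N[x] alone. *)
Lemma rig_evalM (A : pzSemiRingType) (u v : {poly nat}) (a : A) :
  rig_eval (u * v) a = rig_eval u a * rig_eval v a.
Proof.
elim/poly_ind: u => [|u c IHu].
  by rewrite mul0r -[0]/(0%:P) rig_evalC mul0r.
rewrite mulrDl mul_polyC mulrAC !rig_evalD rig_evalZ !rig_evalMX IHu rig_evalC.
by rewrite mulrDl mulrA mulr_natl.
Qed.

(** The witness is a polynomial, so this is the algebraic preorder of the subrig generated by [a],
    pulled back to N[x]. *)
Definition rig_le (A : pzSemiRingType) (a : A) (u v : {poly nat}) : Prop :=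
  exists w : {poly nat}, rig_eval (u + w) a = rig_eval v a.

Lemma rig_le_refl (A : pzSemiRingType) (a : A) (u : {poly nat}) : rig_le a u u.
Proof. by exists 0; rewrite addr0. Qed.

Lemma rig_le_trans (A : pzSemiRingType) (a : A) (v u w : {poly nat}) :
  rig_le a u v -> rig_le a v w -> rig_le a u w.
Proof.
move=> [r ur] [s vs]; exists (r + s).
by rewrite addrA rig_evalD ur -rig_evalD.
Qed.

Lemma rig_le_addr (A : pzSemiRingType) (a : A) (u w : {poly nat}) :
  rig_le a u (u + w).
Proof. by exists w. Qed.

Lemma rig_leD (A : pzSemiRingType) (a : A) (u u' v v' : {poly nat}) :
  rig_le a u v -> rig_le a u' v' -> rig_le a (u + u') (v + v').
Proof.
move=> [r ur] [s us]; exists (r + s).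
by rewrite addrACA !(rig_evalD _ _ a) -ur -us !rig_evalD.
Qed.

Lemma rig_leMr (A : pzSemiRingType) (a : A) (w u v : {poly nat}) :
  rig_le a u v -> rig_le a (u * w) (v * w).
Proof.
by move=> [r ur]; exists (r * w); rewrite -mulrDl !rig_evalM ur.
Qed.

Lemma coef_rig_le (A : pzSemiRingType) (a : A) (u v : {poly nat}) :
  (forall i, ((u`_i)%R <= (v`_i)%R)%N) -> rig_le a u v.
Proof.
(* The truncated subtraction is exact, by [le_uv]. *)
move=> le_uv; exists (\poly_(i < size v) ((v`_i)%R - (u`_i)%R)%N).
congr (rig_eval _ a); apply/polyP=> i; rewrite coefD coef_poly.
case: ltnP => [_|le_vi]; first by rewrite [LHS]subnKC.
apply/eqP; have := le_uv i.
by rewrite addr0 (nth_default _ le_vi) -[_ == _]leqn0.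
Qed.

Lemma Xn_rig_le (A : pzSemiRingType) (a : A) (u : {poly nat}) :
  u != 0 -> rig_le a 'X^((size u).-1) u.
Proof.
move=> u0; apply: coef_rig_le => i; rewrite coefXn.
by case: eqP => // ->; rewrite lt0n -[_`__]/(lead_coef u) lead_coef_eq0.
Qed.

Lemma rig_le_1_Xn (A : pzSemiRingType) (a : A) (n : nat) :
  rig_le a 1 'X -> rig_le a 1 'X^n.
Proof.
move=> le1X; elim: n => [|n IHn]; first exact: rig_le_refl.
rewrite exprS; apply: (rig_le_trans IHn).
by have := rig_leMr 'X^n le1X; rewrite mul1r.
Qed.

Lemma rig_le_Xn (A : pzSemiRingType) (a : A) (m n : nat) :
  rig_le a 1 'X -> (m <= n)%N -> rig_le a 'X^m 'X^n.
Proof.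
move=> le1X le_mn; have := rig_leMr 'X^m (rig_le_1_Xn (n - m) le1X).
by rewrite mul1r -exprD subnK.
Qed.

Lemma X_rig_le_nonconstant (A : pzSemiRingType) (a : A) (u : {poly nat}) :
  rig_le a 1 'X -> (1 <= (size u).-1)%N -> rig_le a 'X u.
Proof.
move=> le1X u1; apply: (rig_le_trans (rig_le_Xn le1X u1)).
by apply: Xn_rig_le; apply: contraTneq u1 => ->; rewrite size_poly0.
Qed.

(** The constant and leading coefficients of [p] are positive and sit at different positions, so [p]
    dominates 1 + x^n coefficientwise, n being its degree; and what lies below [p] lies below x. *)
Lemma fixpoint_rig_le (A : pzSemiRingType) (a : A) (p : {poly nat}) :
  p`_0 <> 0%N -> (2 <= (size p).-1)%N -> rig_eval 'X a = rig_eval p a ->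
  rig_le a 1 'X /\ rig_le a (1 + 'X^2) 'X.
Proof.
move=> /eqP; rewrite -lt0n => p0 p2 Xp.
have lepX u : rig_le a u p -> rig_le a u 'X.
  by move=> [w uw]; exists w; rewrite uw.
have le1X : rig_le a 1 'X.
  by apply/lepX/coef_rig_le=> i; rewrite coef1; case: eqP => // ->.
split=> //; apply: (@rig_le_trans _ _ (1 + 'X^((size p).-1))).
  exact: rig_leD (rig_le_refl _ _) (rig_le_Xn le1X p2).
apply/lepX/coef_rig_le=> i; rewrite coefD coef1 coefXn.
case: eqP => [->|_]; first by rewrite ltn_eqF ?(leq_trans _ p2).
case: eqP => // ->; rewrite lt0n -[_`__]/(lead_coef p) lead_coef_eq0.
by apply: contraTneq p2 => ->; rewrite size_poly0.
Qed.

(** Multiplying 1 + x^2 <= x by x gives x + x^3 <= x^2 <= x, and x <= x^3, so x + x <= x. The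
    polynomials below x are thus closed under sums and under multiplication by x, and Horner
    induction reaches all of N[x]. *)
Lemma rig_le_X (A : pzSemiRingType) (a : A) (u : {poly nat}) :
  rig_le a 1 'X -> rig_le a (1 + 'X^2) 'X -> rig_le a u 'X.
Proof.
move=> le1X leX.
have leX2X : rig_le a 'X^2 'X.
  by apply: rig_le_trans leX; rewrite addrC; apply: rig_le_addr.
have le2X : rig_le a ('X + 'X) 'X.
  have le_XX3 : rig_le a ('X + 'X^3) 'X^2.
    by have := rig_leMr 'X leX; rewrite mulrDl mul1r -exprSr.
  apply: rig_le_trans leX2X; apply: rig_le_trans le_XX3.
  exact: rig_leD (rig_le_refl _ _) (@rig_le_Xn _ _ 1 3 le1X _).
elim/poly_ind: u => [|u c IHu]; first by exists 'X; rewrite add0r.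
apply: (rig_le_trans _ le2X); apply: rig_leD.
  exact: rig_le_trans (rig_leMr 'X IHu) leX2X.
elim: c => [|c IHc]; first by exists 'X; rewrite add0r.
rewrite -addn1 polyCD.
exact: rig_le_trans (rig_leD IHc le1X) le2X.
Qed.

Lemma rig_cancel (A : pzSemiRingType) (a : A) (u v s : {poly nat}) :
  (forall w, rig_le a w 'X) -> rig_le a 'X u -> rig_le a 'X v ->
  rig_eval (u + s) a = rig_eval (v + s) a -> rig_eval u a = rig_eval v a.
Proof.
move=> leX leXu leXv us_vs.
have [w0 Xw0] := leX ('X + 'X).
set z := 'X + w0.
(* If t = x + r, then t + z = (x + x + w0) + r = x + r = t. *)
have z_neutral t : rig_le a 'X t -> rig_eval t a = rig_eval (t + z) a.
  rewrite rig_evalD => -[r <-]; rewrite -rig_evalD addrAC rig_evalD.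
  by rewrite [RHS]rig_evalD addrA Xw0.
have [w sw] : rig_le a s z by apply: rig_le_trans (leX s) (rig_le_addr _ _ _).
(* Now u = u + z = u + s + w = v + s + w = v + z = v at [a]. *)
rewrite (z_neutral u) // (z_neutral v) //.
rewrite rig_evalD [RHS]rig_evalD -sw !rig_evalD.
by rewrite !addrA -!(rig_evalD _ s) us_vs.
Qed.

(** Up to a nonzero constant, [f] is a product of linear factors; simplicity of the roots makes
    these pairwise distinct, and each divides [g]. *)
Lemma simple_roots_dvdp (F : closedFieldType) (f g : {poly F}) :
  f != 0 -> (forall t, root f t -> mup t f = 1%N) ->
  (forall t, root f t -> root g t) -> f %| g.
Proof.
move=> f0 f_simple fg; have [r def_f] := closed_field_poly_normal f.
have lc0 : lead_coef f != 0 by rewrite lead_coef_eq0.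
have rootE t : root f t = (t \in r).
  by rewrite def_f rootZ // root_prod_XsubC.
rewrite def_f dvdpZl //; apply: uniq_roots_dvdp.
  by apply/allP => t tr; apply: fg; rewrite rootE.
rewrite uniq_rootsE; apply: count_mem_uniq => t.
have [tr|/count_memPn //] := boolP (t \in r).
rewrite -mu_prod_XsubC -[RHS](f_simple t) ?rootE //.
by rewrite [in RHS]def_f -mul_polyC mupMr ?rootC.
Qed.

Lemma int_poly_nat_diff (r : {poly int}) :
  exists s1 s2 : {poly nat}, r = map_poly Posz s1 - map_poly Posz s2.
Proof.
exists (\poly_(i < size r) (if 0 <= r`_i then `|(r`_i)%R|%N else 0%N)).
exists (\poly_(i < size r) (if 0 <= r`_i then 0%N else `|(r`_i)%R|%N)).
apply/polyP => i; rewrite coefB !coef_map !coef_poly /=.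
case: ltnP => [_|le_ri]; last by rewrite nth_default.
case: ifPn => [r0|]; first by rewrite subr0 gez0_abs.
by rewrite -ltNge => r0; rewrite sub0r ltz0_abs ?opprK.
Qed.

Lemma rig_eval_complex_poly (R : realType) (q : {poly nat}) (t : complex R) :
  rig_eval q t = (complex_poly R (map_poly Posz q)).[t].
Proof.
rewrite rig_evalE; congr (_.[t]); apply/polyP=> i.
by rewrite /complex_poly !coef_map_id0.
Qed.

Lemma fixpoint_poly_dvd (R : realType) (p q1 q2 : {poly nat}) :
  primitive_zpoly (fixpoint_poly p) ->
  no_repeated_complex_roots R (fixpoint_poly p) ->
  (forall t : complex R, root (complex_poly R (fixpoint_poly p)) t ->
     rig_eval q1 t = rig_eval q2 t) ->
  exists r : {poly int},
    map_poly Posz q1 - map_poly Posz q2 = fixpoint_poly p * r.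
Proof.
set f := fixpoint_poly p; set g := _ - _ => prim_f f_simple fq.
have f0 : f != 0 by apply: contra_eqN prim_f => /eqP ->; rewrite zcontents0.
have complexE h :
    complex_poly R h = map_poly ratr (map_poly intr h : {poly rat}).
  rewrite /complex_poly -map_poly_comp; apply/polyP=> i.
  by rewrite !coef_map_id0 //= ratr_int.
(* Over the integers [%|] is pseudo-division, which amounts to divisibility over the rationals; that
   in turn can be tested over the complex numbers. *)
have : f %| g.
  rewrite -dvdp_rat_int -(dvdp_map (ratr : {rmorphism rat -> complex R})).
  rewrite -!complexE.
  apply: simple_roots_dvdp => //.
    rewrite complexE map_poly_eq0.
    by rewrite map_poly_eq0_id0 // intr_eq0 lead_coef_eq0.
  move=> t /fq; rewrite !rig_eval_complex_poly /root /g /complex_poly.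
  by rewrite rmorphB hornerD hornerN => ->; rewrite subrr.
move=> /dvdpP_int [r ->].
(* Here [r] is the quotient by the primitive part of [f]. The content of [f] is 1 or -1, so its
   square disappears. *)
exists (zcontents f *: r).
rewrite [X in _ = X * _]zpolyEprim -scalerAl -scalerAr scalerA -expr2.
by rewrite [zcontents f]intEsign prim_f mulr1 sqrr_sign scale1r.
Qed.

Theorem theorem5p2 (R : realType) (p q1 q2 : {poly nat})
    (hp0 : p`_0 <> 0%N) (hp : (2 <= (size p).-1)%N)
    (hq1 : (1 <= (size q1).-1)%N) (hq2 : (1 <= (size q2).-1)%N)
    (hprim : primitive_zpoly (fixpoint_poly p))
    (hsep : no_repeated_complex_roots R (fixpoint_poly p))
    (hroots : forall t : complex R,
        root (complex_poly R (fixpoint_poly p)) t ->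
        rig_eval q1 t = rig_eval q2 t) :
  rig_implies 'X p q1 q2.
Proof.
have [r def_r] := fixpoint_poly_dvd hprim hsep hroots.
have [s1 [s2 def_s]] := int_poly_nat_diff r.
(* This is q1 - q2 = (p - x)(s1 - s2) with all negative terms moved across, hence an equation in
   N[x]. *)
have identity : q1 + ('X * s1 + p * s2) = q2 + (p * s1 + 'X * s2).
  apply: (@map_inj_poly _ _ Posz) => //; first by move=> m n [].
  apply/eqP; rewrite -subr_eq0 !rmorphD !rmorphM /= map_polyX opprD addrACA.
  rewrite def_r def_s /fixpoint_poly.
  by apply/eqP; ring.
move=> A a Xp; have [le1X leX] := fixpoint_rig_le hp0 hp Xp.
(* Once x = p(x) at [a], the terms added to [q1] and to [q2] both take the value of p s1 + p s2. *)
apply: (@rig_cancel _ _ _ _ (p * s1 + p * s2)).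
- by move=> w; apply: rig_le_X.
- exact: X_rig_le_nonconstant.
- exact: X_rig_le_nonconstant.
have := congr1 (fun u => rig_eval u a) identity.
by rewrite !rig_evalD !rig_evalM Xp.
Qed.
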